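(* Let $F$ be a field, let $n\ge 1$, let $A=\{a_1,\ldots,a_n\}\subset F$ consist of $n$ distinct nonzero elements, and let $k\in\mathbb{N}=\{0,1,2,\ldots\}$. Put $u=a_1\cdots a_n$, $A^{\vee}=\{a_1^{-1},\ldots,a_n^{-1}\}$ and $R(x,A)=\prod_{a\in A}(x-a)$. Then the remainder of $x^{-k}$ modulo $R(x,A)$ is equal to (i) $S_{k^{n-1}}(A-x)\,u^{-k}$; and also to (ii) $(-1)^{n-1}x^{n-1}S_{1^{n-1};\,k}(A^{\vee}-x^{-1};\,A^{\vee})$. (iii) Moreover, given a finite alphabet $B$ of elements of $F$ of cardinality $m$, the remainder modulo $R(x,A)$ of $R(x^{-1},B)=\prod_{b\in B}(x^{-1}-b)$ is equal to $(-1)^{n-1}x^{n-1}S_{1^{n-1};\,m}(A^{\vee}-x^{-1};\,A^{\vee}-B)$.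
   Context: Remainder: if $f$ is a polynomial in $x^{-1}$ over $F$, there is a unique polynomial $r(x)\in F[x]$ of degree $<n$ such that $f=q(x)R(x,A)+r(x)$ for some polynomial $q$ in $x^{-1}$; $r(x)$ is called the remainder of $f$ modulo $R(x,A)$. Equivalently, $r$ is the unique polynomial of degree $\le n-1$ with $r(a)=f(a)$ for all $a\in A$. Complete symmetric functions: for finite alphabets $C,D$, the functions $S_k(C-D)=S^k(C-D)$ are defined by $\sum_{k\ge 0}S^k(C-D)z^k=\dfrac{\prod_{d\in D}(1-dz)}{\prod_{c\in C}(1-cz)}$, with $S_k(C-D)=0$ for $k<0$. An empty $D$ is omitted from the notation ($S_k(C)$), and a single element $y$ is identified with the alphabet $\{y\}$; e.g. $S_k(A-x)=S_k(A-\{x\})=S_k(A)-xS_{k-1}(A)$. Multi-Schur functions: for $J=(j_1,\ldots,j_p)\in\mathbb{N}^p$ and alphabets $C_1,\ldots,C_p$, $D_1,\ldots,D_p$, $$S_J(C_1-D_1;\ldots;C_p-D_p)=\det\bigl(S_{j_k+k-l}(C_k-D_k)\bigr)_{1\le l,k\le p}$$ ($l$ is the row index and $k$ the column index; an empty determinant is $1$). If all columns have the same argument $C-D$ one writes $S_J(C-D)$. The notation $k^{n-1}$ means $k$ repeated $n-1$ times, so $S_{k^{n-1}}(A-x)$ is an $(n-1)\times(n-1)$ determinant. The notation $S_{1^{n-1};\,k}(C-D;\,C'-D')$ denotes the multi-Schur function of index $(1,\ldots,1,k)\in\mathbb{N}^n$ whose first $n-1$ columns all have argument $C-D$ and whose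 last column has argument $C'-D'$. *)

(* Defs.v *)
From HB Require Import structures.
From mathcomp Require Import all_boot all_order all_algebra.
From mathcomp Require Import fraction.

Set Implicit Arguments.
Unset Strict Implicit.
Unset Printing Implicit Defensive.

Import GRing.Theory.
Local Open Scope ring_scope.

(* Finite alphabets are sequences, so letters may be repeated. *)

Notation "x %:F" := (@FracField.tofrac _ x) : ring_scope.

Section CompleteSymmetric.
Variable K : comNzRingType.
Implicit Types C D : seq K.

(* Coefficient of z^k in \prod_d (1 - d z) * \prod_c 1 / (1 - c z): modulo
   z^(k+1) the series 1 / (1 - c z) is the sum of the c^i z^i for i <= k. *)
Definition csymn C D (k : nat) : K :=
  (\prod_(d <- D) (1 - d *: 'X) *
   \prod_(c <- C) \poly_(i < k.+1) c ^+ i)`_k.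

Definition csym C D (k : int) : K :=
  match k with Posz k => csymn C D k | Negz _ => 0 end.

Lemma geom_trunc C (k i : nat) (Q : {poly K}) : (i <= k)%N ->
  (Q * \prod_(c <- C) \poly_(j < k.+1) c ^+ j)`_i =
  (Q * \prod_(c <- C) \poly_(j < i.+1) c ^+ j)`_i.
Proof.
move=> le_ik; elim: C Q => [|c C IH] Q; first by rewrite !big_nil.
rewrite !big_cons mulrA IH mulrAC mulrA [in RHS]mulrAC !coefM.
apply: eq_bigr => j _; congr (_ * _).
by rewrite !coef_poly !ltnS leq_subr (leq_trans (leq_subr _ _) le_ik).
Qed.

(* The generating function identity \prod_c (1 - c z) * \sum_k S_k(C - D) z^k
   = \prod_d (1 - d z), coefficientwise. *)
Lemma csymn_gen C D (k : nat) :
  \sum_(j < k.+1) (\prod_(c <- C) (1 - c *: 'X))`_j * csymn C D (k - j) =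
  (\prod_(d <- D) (1 - d *: 'X))`_k.
Proof.
set P := \prod_(c <- C) _; set N := \prod_(d <- D) _.
pose T := \prod_(c <- C) \poly_(j < k.+1) c ^+ j.
transitivity ((P * (N * T))`_k).
  rewrite coefM; apply: eq_bigr => j _; congr (_ * _).
  by rewrite /csymn -(@geom_trunc _ k) ?leq_subr.
have -> : P * (N * T) = N * \prod_(c <- C) (1 - c ^+ k.+1 *: 'X^(k.+1)).
  rewrite mulrCA /P /T -big_split /=; congr (_ * _).
  apply: eq_bigr => c _; rewrite poly_def.
  have -> : \sum_(i < k.+1) c ^+ i *: 'X^i = \sum_(i < k.+1) (c *: 'X) ^+ i.
    by apply: eq_bigr => i _; rewrite exprZn.
  rewrite -exprZn -[in RHS](expr1n _ k.+1) subrXX.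
  by congr (_ * _); apply: eq_bigr => i _; rewrite expr1n mul1r.
clear P T; elim: C N => [|c C IH] N; first by rewrite big_nil mulr1.
rewrite big_cons mulrA IH mulrBr mulr1 coefB -scalerAr coefZ coefMXn ltnSn.
by rewrite mulr0 subr0.
Qed.

Definition multischur (p : nat) (J : 'I_p -> nat) (C D : 'I_p -> seq K) : K :=
  \det (\matrix_(l < p, k < p)
          csym (C k) (D k) ((J k)%:Z + (k : nat)%:Z - (l : nat)%:Z)).

(* S_{k^p}(C - D) *)
Definition schur_rect (p k : nat) C D : K :=
  multischur (fun _ : 'I_p => k) (fun _ => C) (fun _ => D).

(* S_{1^(n-1); k}(C - D; C' - D') *)
Definition schur_col (n k : nat) C D C' D' : K :=
  multischur (fun i : 'I_n => if (i < n.-1)%N then 1%N else k)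
             (fun i => if (i < n.-1)%N then C else C')
             (fun i => if (i < n.-1)%N then D else D').

Definition Rprod (t : K) C : K := \prod_(c <- C) (t - c).

End CompleteSymmetric.

Section Remainder.
Variable F : fieldType.
Implicit Types (p q r : {poly F}) (A : seq F).
Local Notation K := {fraction {poly F}}.

(* The indeterminate x, as an element of F(x). *)
Definition indet : K := ('X : {poly F})%:F.

Definition cst (a : F) : K := (a%:P)%:F.

Definition alph A : seq K := map cst A.

(* q(x^-1) *)
Definition poly_inv q : K := (map_poly cst q).[indet^-1].

(* All identities are read in F(x), which contains F[x] and F[x^-1]. *)
Definition is_remainder A (f : K) r : Prop :=
  (size r <= size A)%N /\
  exists q, f = poly_inv q * Rprod indet (alph A) + r%:F.

Let rev (d : nat) q : {poly F} := \poly_(i < d.+1) q`_(d - i).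

Lemma poly_invE d q : (size q <= d.+1)%N ->
  indet ^+ d * poly_inv q = (rev d q)%:F.
Proof.
have x0 : indet != 0 by rewrite /indet tofrac_eq0 polyX_eq0.
have c0 : cst 0 = 0 by rewrite /cst tofrac0.
move=> sq; rewrite /poly_inv (horner_coef_wide (n := d.+1)); last first.
  by apply: leq_trans sq; rewrite map_polyE (leq_trans (size_Poly _)) ?size_map.
rewrite /rev poly_def rmorph_sum mulr_sumr (reindex_inj rev_ord_inj) /=.
apply: eq_bigr => i _; rewrite subSS coef_map_id0 // /cst.
rewrite -mul_polyC rmorphM rmorphXn mulrCA; congr (_ * _).
have le_id : (i <= d)%N by rewrite -ltnS.
rewrite -{1}(subnKC le_id) exprD exprVn mulfK ?expf_neq0 //.
Qed.

Lemma revK d q : (size q <= d.+1)%N -> rev d (rev d q) = q.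
Proof.
move=> sq; apply/polyP => i; rewrite coef_poly.
case: ltnP => [|le_di]; last by rewrite nth_default ?(leq_trans sq).
by rewrite ltnS => le_id; rewrite coef_poly ltnS leq_subr subKn.
Qed.

Lemma RprodE A : Rprod indet (alph A) = (\prod_(a <- A) ('X - a%:P))%:F.
Proof.
rewrite /Rprod big_map rmorph_prod; apply: eq_bigr => a _.
by rewrite rmorphB.
Qed.

Lemma remainder_exists_unique A q : 0 \notin A ->
  exists! r, is_remainder A (poly_inv q) r.
Proof.
move=> A0; set R := \prod_(a <- A) ('X - a%:P).
have sR : size R = (size A).+1 by rewrite size_prod_XsubC.
have R0 : R != 0 by rewrite -size_poly_eq0 sR.
have x0 : indet != 0 by rewrite /indet tofrac_eq0 polyX_eq0.
have cop d : coprimep R 'X^d.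
  rewrite coprimep_expr // -['X]subr0 -polyC0 coprimep_XsubC.
  by rewrite root_prod_XsubC.
have uni r1 r2 : is_remainder A (poly_inv q) r1 ->
    is_remainder A (poly_inv q) r2 -> r1 = r2.
  move=> [s1 [q1 ->]] [s2 [q2]]; rewrite RprodE -/R => e.
  pose d := maxn (size q1) (size q2).
  have E1 := @poly_invE d q1 (leqW (leq_maxl _ _)).
  have E2 := @poly_invE d q2 (leqW (leq_maxr _ _)).
  have e' : rev d q1 * R + 'X^d * r1 = rev d q2 * R + 'X^d * r2.
    apply/eqP; rewrite -tofrac_eq !rmorphD !rmorphM /= !rmorphXn /= -E1 -E2.
    by rewrite -!mulrA -!mulrDr e.
  have dv : R %| r1 - r2.
    rewrite -(Gauss_dvdpr _ (cop d)) mulrBr.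
    have -> : 'X^d * r1 - 'X^d * r2 = (rev d q2 - rev d q1) * R.
      by rewrite mulrBl; apply/eqP; rewrite subr_eq addrAC -e' addrC addKr.
    exact: dvdp_mull.
  apply/eqP; rewrite -subr_eq0; apply: contraTT dv => nz.
  apply: contraL (leqnn (size R)) => /(dvdp_leq nz) h.
  rewrite -ltnNge sR ltnS; move: h; rewrite sR => h.
  have: (size (r1 - r2)%R <= size A)%N.
    by apply: leq_trans (size_polyD _ _) _; rewrite size_polyN geq_max s1 s2.
  by move/(leq_trans h); rewrite ltnn.
pose d := size q; pose P := rev d q.
have E := @poly_invE d q (leqnSn _).
have [[u v] /= uv] := Bezout_eq1_coprimepP _ _ (cop d).
pose r := (v * P) %% R.
have sr : (size r <= size A)%N by rewrite -ltnS -sR ltn_modp.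
have /dvdpP[Q eQ] : R %| P - 'X^d * r.
  have -> : P - 'X^d * r = u * P * R + 'X^d * (v * P - r).
    rewrite -{1}[P]mul1r -uv mulrBr mulrDl mulrAC addrA; congr (_ + _ - _).
    by rewrite mulrAC mulrC.
  rewrite dvdp_add ?dvdp_mull // {1}(divp_eq (v * P) R) addrK.
  exact: dvdp_mull.
have sQ : (size Q <= d.+1)%N.
  have [->|Q0] := eqVneq Q 0; first by rewrite size_poly0.
  rewrite -(leq_add2r (size A)) -[(size Q + _)%N]/((size Q + (size A).+1.-1)%N).
  rewrite -sR; have := size_mul Q0 R0; rewrite sR addnS /= => <-; rewrite -eQ.
  apply: leq_trans (size_polyD _ _) _; rewrite size_polyN geq_max; apply/andP.
  split; first by rewrite (leq_trans (size_poly _ _)) ?leq_addr.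
  apply: leq_trans (size_polyMleq _ _) _; rewrite size_polyXn addSn /=.
  by rewrite addSn leqW // leq_add2l.
have rem : is_remainder A (poly_inv q) r.
  split=> //; exists (rev d Q); rewrite RprodE -/R.
  apply: (mulfI (expf_neq0 d x0)); rewrite mulrDr mulrA E.
  rewrite (@poly_invE d (rev d Q)) ?size_poly // revK // -rmorphXn -!rmorphM.
  by rewrite -rmorphD -eQ subrK.
by exists r; split=> // r'; apply: uni.
Qed.

End Remainder.

Arguments indet {F}.

(* Main.v *)
Require Import Defs.
From HB Require Import structures.
From mathcomp Require Import all_boot all_order all_algebra.
From mathcomp Require Import fraction perm.
From mathcomp Require Import ring zify.

Set Implicit Arguments.
Unset Strict Implicit.
Unset Printing Implicit Defensive.

Import GRing.Theory.
Local Open Scope ring_scope.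

(** The remainder of q(x^-1) modulo R(x, A) is the only polynomial of degree
less than n taking the value q(a^-1) at each letter a of A, so each formula is
proved by bounding a degree and evaluating at every a
([remainder_interpolation]).

Everything rests on two properties of the S_j(C - D). First, a letter present
on both sides cancels ([csym_cancel]). Second, adding letters D' to the
subtracted alphabet amounts to convolving the sequence j |-> S_j(C - D) with
the coefficients of \prod_(d in D') (1 - d z) ([csym_catr]).

- At x = a, the determinant S_(k^(n-1))(A - x) becomes S_(k^(n-1))(C), where
  C = A \ a has exactly n - 1 letters.  By the convolution rule, j |-> S_j(C)
  satisfies a linear recurrence of order n - 1, so that increasing k by one
  multiplies the matrix by a companion matrix, of determinant \prod_(c in C) c.
  Hence the value is (u / a)^k ([schur_rect_factor]), and division by u^k
  gives a^-k.

- At x = a, the first n - 1 columns of the determinant of (iii) have argument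
  C = A^v \ a^-1, again with n - 1 letters.  Replacing the top row by the
  combination of all rows with the coefficients of \prod_(c in C) (1 - c z)
  kills every entry of this row but the last, which becomes
  S_(m+n-1)(a^-1 - B) = a^-(n-1) \prod_(b in B) (a^-1 - b).  The complementary
  minor is unitriangular ([schur_col_letter]).

Formula (ii) is formula (iii) for the alphabet B of k zeros, for which
R(x^-1, B) = x^-k.

The determinants live in F(x), where neither degree nor evaluation makes
sense.  They are therefore obtained as images of determinants over F[x], using
that the constructions commute with ring morphisms: one morphism is the
embedding of F[x] in F(x), the other is the evaluation at a.  For the
determinant in x^-1 this needs the factor x^(n-1) to be distributed over the
first n - 1 columns ([cleared_col]). *)

(** * Complete symmetric functions *)

Section CompleteSymmetricTheory.
Variable K : comNzRingType.
Implicit Types C D : seq K.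

Lemma csym_neg C D (j : int) : j < 0 -> csym C D j = 0.
Proof. by case: j. Qed.

Lemma csym_perm C C' D : perm_eq C C' -> csym C D =1 csym C' D.
Proof. by move=> eqC [j|j] //=; rewrite /csymn (perm_big _ eqC). Qed.

Lemma csym_nil (j : int) : csym [::] [::] j = (j == 0)%:R :> K.
Proof. by case: j => [j|j] //=; rewrite /csymn !big_nil mulr1 coef1. Qed.

Lemma size_numer D : (size (\prod_(d <- D) (1 - d *: 'X))%R <= (size D).+1)%N.
Proof.
elim: D => [|d D IH]; first by rewrite big_nil size_poly1.
rewrite big_cons; apply: leq_trans (size_polyMleq _ _) _.
have s2 : (size (1 - d *: 'X : {poly K})%R <= 2)%N.
  apply: leq_trans (size_polyD _ _) _; rewrite size_poly1 size_polyN geq_max /=.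
  by apply: leq_trans (size_scale_leq _ _) _; rewrite size_polyX.
by rewrite -subn1 leq_subLR; apply: leq_trans (leq_add s2 IH) _; rewrite add2n.
Qed.

Lemma lead_numer D :
  (\prod_(d <- D) (1 - d *: 'X))`_(size D) =
  (-1) ^+ size D * \prod_(d <- D) d.
Proof.
elim: D => [|d D IH]; first by rewrite !big_nil coef1 mulr1.
rewrite !big_cons mulrBl mul1r coefB -scalerAl coefZ coefXM /= IH.
by rewrite nth_default ?size_numer // sub0r mulrCA exprS mulN1r mulNr.
Qed.

Lemma numer0 D : (\prod_(d <- D) (1 - d *: 'X))`_0 = 1.
Proof.
elim: D => [|d D IH]; first by rewrite big_nil coef1.
by rewrite big_cons mulrBl mul1r coefB -scalerAl coefZ coefXM mulr0 subr0.
Qed.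

(** Adding D' to the subtracted alphabet multiplies the generating function by
\prod_(d <- D') (1 - d z).  The bound p, which does not depend on j, lets the sum
range over the rows of a matrix; the value 0 of csym at negative indices absorbs
the terms with l > j. *)
Lemma csym_catr (p : nat) C D' D (j : int) : (size D' <= p)%N ->
  csym C (D' ++ D) j =
  \sum_(l < p.+1) (\prod_(d <- D') (1 - d *: 'X))`_l
                  * csym C D (j - (l : nat)%:Z).
Proof.
move=> sD; case: j => [j|j]; last first.
  by rewrite big1 //= => l _; rewrite csym_neg ?mulr0 // NegzE; lia.
set P := \prod_(d <- D') _.
have P0 l : (p < l)%N -> P`_l = 0.
  by move=> pl; rewrite nth_default // (leq_trans (size_numer _)) //; lia.
pose G (l : nat) := P`_l * csym C D (j%:Z - l%:Z).
rewrite /= /csymn big_cat /= -/P -mulrA coefM.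
(* The product of polynomials gives j + 1 terms instead of p + 1: the terms
   of index above minn j p vanish. *)
transitivity (\sum_(l < j.+1) G l).
  apply: eq_bigr => l _; rewrite /G; congr (_ * _).
  have le_lj : (l <= j)%N by rewrite -ltnS.
  by rewrite subzn //= /csymn geom_trunc // leq_subr.
rewrite -(big_mkord xpredT G) -[RHS](big_mkord xpredT G).
have G0 a b : (forall l, (a <= l)%N -> G l = 0) -> (a <= b)%N ->
    \sum_(0 <= l < b) G l = \sum_(0 <= l < a) G l.
  move=> Ga ab; rewrite (big_cat_nat (leq0n a) ab) /= addrC big_nat_cond big1.
    by rewrite add0r.
  by move=> l /andP[/andP[/Ga]].
have G1 l : (minn j.+1 p.+1 <= l)%N -> G l = 0.
  rewrite geq_min => /orP[jl|pl]; rewrite /G.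
    by rewrite csym_neg ?mulr0 //; lia.
  by rewrite P0 ?mul0r.
by rewrite (G0 _ j.+1 G1) ?geq_minl // (G0 _ p.+1 G1) ?geq_minr.
Qed.

Lemma csym_consr C d D (j : int) :
  csym C (d :: D) j = csym C D j - d * csym C D (j - 1).
Proof.
rewrite (@csym_catr 1 C [:: d] D) // !big_ord_recl big_ord0 big_seq1 /= subr0.
rewrite !coefB !coef1 !coefZ !coefX /= mulr0 mulr1 subr0 sub0r mul1r addr0.
by rewrite mulNr.
Qed.

Lemma csym_cancel c C D (j : int) : csym (c :: C) (c :: D) j = csym C D j.
Proof.
case: j => [j|j] //=; rewrite /csymn !big_cons.
set N := \prod_(d <- D) _; set T := \prod_(d <- C) _.
have -> : (1 - c *: 'X) * N * (\poly_(i < j.+1) c ^+ i * T) =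
          (1 - c ^+ j.+1 *: 'X^(j.+1)) * (N * T).
  rewrite mulrACA; congr (_ * _).
  rewrite poly_def -exprZn -[in RHS](expr1n _ j.+1) subrXX; congr (_ * _).
  by apply: eq_bigr => i _; rewrite expr1n mul1r exprZn.
by rewrite mulrBl mul1r coefB -scalerAl coefZ coefXnM ltnSn mulr0 subr0.
Qed.

Lemma csym_cancel_cat C C' D (j : int) :
  csym (C ++ C') (C ++ D) j = csym C' D j.
Proof. by elim: C => //= c C <-; rewrite csym_cancel. Qed.

Lemma csym_diag C (j : int) : csym C C j = (j == 0)%:R.
Proof. by rewrite -csym_nil -(csym_cancel_cat C [::] [::]) !cats0. Qed.

Lemma csym0 C D : csym C D 0 = 1.
Proof.
elim: D C => [|d D IH] C; last by rewrite csym_consr IH csym_neg ?mulr0 ?subr0.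
elim: C => [|c C IH]; first by rewrite csym_nil.
rewrite -IH -[RHS](csym_cancel c) csym_consr [csym _ _ (0 - 1)]csym_neg //.
by rewrite mulr0 subr0.
Qed.

(** From the index size D on, the convolution of the powers of c with the
coefficients of \prod_(d <- D) (1 - d z) is no longer truncated, whence the
geometric growth. *)
Lemma csym_letter c D (i : nat) :
  csym [:: c] D (size D + i)%N = c ^+ i * \prod_(d <- D) (c - d).
Proof.
elim: D i => [|d D IH] i.
  rewrite big_nil mulr1 add0n /= /csymn big_nil mul1r big_seq1 coef_poly.
  by rewrite ltnSn.
rewrite -[size (d :: D)]/(size D).+1 big_cons csym_consr addSn -addnS IH.
have -> : (size D + i.+1)%N%:Z - 1 = (size D + i)%N by lia.
by rewrite IH exprS; ring.
Qed.

End CompleteSymmetricTheory.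

(** The polynomials defining csymn need not be followed through f: the
recurrences for a letter added to D and for a letter added to C determine all
values. *)
Lemma map_csym (K L : comNzRingType) (f : {rmorphism K -> L}) C D (j : int) :
  csym (map f C) (map f D) j = f (csym C D j).
Proof.
elim: D j => [|d D IH] j; last first.
  by rewrite /= !csym_consr !IH rmorphB rmorphM.
elim: C j => [|c C IH] j; first by rewrite !csym_nil rmorph_nat.
(* The recurrence for a letter c of C lowers the index j, which vanishes once
   j is negative. *)
have [n le_jn] : exists n : nat, (j < n%:Z)%R by exists (absz j).+1; lia.
elim: n j le_jn => [|n IHn] j lt_jn; first by rewrite !csym_neg ?rmorph0.
have E (M : comNzRingType) (b : M) B :
    csym (b :: B) [::] j = csym B [::] j + b * csym (b :: B) [::] (j - 1).
  by rewrite -[csym B _ _](csym_cancel b) csym_consr subrK.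
rewrite /= !E IH rmorphD rmorphM -IHn //; lia.
Qed.

(** * Evaluation of the determinants *)

Section Determinants.
Variable K : comNzRingType.
Implicit Types C D : seq K.

Lemma det_unitriangular p (M : 'M[K]_p) :
  (forall i j : 'I_p, (j < i)%N -> M i j = 0) -> (forall i, M i i = 1) ->
  \det M = 1.
Proof.
move=> M0 M1; rewrite -det_tr det_trig; last first.
  by apply/is_trig_mxP => i j lt_ij; rewrite mxE M0.
by rewrite big1 // => i _; rewrite mxE M1.
Qed.

Lemma det_scale_cols p (s : 'I_p -> K) (M : 'M[K]_p) :
  \det (\matrix_(i, j) (s j * M i j)) = (\prod_j s j) * \det M.
Proof.
have -> : \matrix_(i, j) (s j * M i j) = M *m diag_mx (\row_j s j).
  by apply/matrixP=> i j; rewrite mul_mx_diag !mxE mulrC.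
rewrite det_mulmx det_diag mulrC; congr (_ * _).
by apply: eq_bigr => j _; rewrite mxE.
Qed.

(** The top row is replaced by the combination of the rows with weights w,
which leaves the determinant unchanged because w 0 = 1; expansion along the new
top row leaves only its last entry, whose minor is unitriangular. *)
Lemma det_row0_comb p (w : 'I_p.+1 -> K) (M : 'M[K]_p.+1) :
  w 0 = 1 -> (forall j : 'I_p, \sum_l w l * M l (widen_ord (leqnSn p) j) = 0) ->
  (forall i j : 'I_p.+1, (0 < i)%N -> (j.+1 < i)%N -> M i j = 0) ->
  (forall i j : 'I_p.+1, i = j.+1 :> nat -> M i j = 1) ->
  \det M = (- 1) ^+ p * \sum_l w l * M l ord_max.
Proof.
move=> w0 M0 Mlow M1.
pose E : 'M[K]_p.+1 := \matrix_(i, j) if i == 0 then w j else (i == j)%:R.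
have detE : \det E = 1.
  apply: det_unitriangular => [i j lt_ji|i]; rewrite mxE.
    have -> : (i == 0) = false by apply/eqP => i0; rewrite i0 in lt_ji.
    by rewrite -val_eqE gtn_eqF.
  by case: eqP => [->|_] //; rewrite eqxx.
have EM0 j : (E *m M) 0 j = \sum_l w l * M l j.
  by rewrite mxE; apply: eq_bigr => l _; rewrite mxE eqxx.
have EMi i j : i != 0 -> (E *m M) i j = M i j.
  move=> i0; rewrite mxE (bigD1 i) //= big1 => [|l li].
    by rewrite mxE (negPf i0) eqxx mul1r addr0.
  by rewrite mxE (negPf i0) eq_sym (negPf li) mul0r.
have -> : \det M = \det (E *m M) by rewrite det_mulmx detE mul1r.
rewrite (expand_det_row _ 0) big_ord_recr /=.
rewrite big1 ?add0r => [|j _]; last by rewrite EM0 M0 mul0r.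
rewrite EM0 mulrC; congr (_ * _).
rewrite /cofactor add0n -[RHS]mulr1; congr (_ * _).
have lj (j : 'I_p) : lift ord_max j = j :> nat by rewrite lift_max.
apply: det_unitriangular => [i j lt_ji|i]; rewrite 2!mxE EMi //.
  by apply: Mlow; rewrite lift0 ?lj.
by apply: M1; rewrite lift0 lj.
Qed.

(** Passing from k to k + 1 moves every row down by one place and creates the
new top row by the linear recurrence satisfied by j |-> S_j(C); this is
multiplication by a companion matrix of determinant \prod_(c <- C) c. *)
Lemma schur_rect_factor k C :
  schur_rect (size C) k C [::] = (\prod_(c <- C) c) ^+ k.
Proof.
move sC : (size C) => n; case: n sC => [|p] sC.
  by rewrite (size0nil sC) big_nil expr1n /schur_rect /multischur det_mx00.
rewrite /schur_rect /multischur; set P := \prod_(c <- C) (1 - c *: 'X).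
elim: k => [|k IH].
  rewrite expr0; apply: det_unitriangular => [i j lt_ji|i]; rewrite mxE.
    by rewrite csym_neg //; lia.
  by rewrite add0r subrr csym0.
pose T : 'M[K]_p.+1 :=
  \matrix_(i, j) if i == 0 then - P`_j.+1 else (i == j.+1 :> nat)%:R.
have detT : \det T = \prod_(c <- C) c.
  rewrite (expand_det_col _ ord_max) (bigD1 0) //= big1 ?addr0 => [|i i0].
    rewrite !mxE eqxx /= /cofactor.
    have -> : \det (row' 0 (col' ord_max T)) = 1.
      apply: det_unitriangular => [i j lt_ji|i]; rewrite !mxE lift0 lift_max /=.
        by rewrite eqSS gtn_eqF.
      by rewrite eqxx.
    have -> : P`_(@ord_max p).+1 = (-1) ^+ p.+1 * \prod_(c <- C) c.
      by rewrite -sC -lead_numer sC.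
    rewrite mulr1 add0n exprS mulN1r mulNr opprK mulrAC -exprD addnn -mul2n.
    by rewrite mulnC exprM sqrr_sign mul1r.
  by rewrite !mxE (negPf i0) ltn_eqF ?mul0r.
rewrite exprS -IH -detT -det_mulmx; congr (\det _); apply/matrixP => i j.
rewrite !mxE; have [i0|i0] := eqVneq i 0.
  have /esym/eqP := @csym_catr _ p.+1 C C [::] (k.+1 + j)%N%:Z (eq_leq sC).
  (* S_j(C - C) = 0 for j > 0 is the recurrence. *)
  rewrite cats0 csym_diag big_ord_recl numer0 mul1r subr0 addr_eq0 => /eqP E.
  rewrite i0 subr0 -PoszD E -sumrN; apply: eq_bigr => l _.
  rewrite !mxE eqxx mulNr; congr (- (_ * csym _ _ _)).
  rewrite lift0; lia.
have lt_i : (i.-1 < p.+1)%N := leq_ltn_trans (leq_pred i) (ltn_ord i).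
rewrite (bigD1 (Ordinal lt_i)) //= big1 ?addr0 => [|l li].
  rewrite !mxE (negPf i0) /= prednK ?eqxx ?mul1r ?lt0n //.
  congr (csym _ _ _); move: i0; rewrite -val_eqE /=; lia.
rewrite !mxE (negPf i0); case: eqP => [il|]; last by rewrite mul0r.
by case/eqP: li; apply: val_inj; rewrite /= il.
Qed.

(** Cancellation of c turns the argument of the first columns into C, whose
generating polynomial \prod_(c <- C) (1 - c z) then provides row weights that
annihilate them: S_(j+1)(C - C) = 0. *)
Lemma schur_col_letter c C D :
  schur_col (size C).+1 (size D) (c :: C) [:: c] (c :: C) D =
  (- c) ^+ size C * \prod_(d <- D) (c - d).
Proof.
set p := size C; rewrite /schur_col /multischur.
rewrite (@det_row0_comb _ (fun l => (\prod_(c <- C) (1 - c *: 'X))`_l)).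
- transitivity ((-1) ^+ p * csym (c :: C) (C ++ D) (size D + p)%N).
    rewrite (@csym_catr _ p) //; congr (_ * _); apply: eq_bigr => l _.
    by rewrite mxE /= ltnn.
  rewrite (@csym_perm _ _ (C ++ [:: c])); last by rewrite -cat1s perm_catC.
  by rewrite csym_cancel_cat csym_letter mulrA -exprMn mulN1r.
- exact: numer0.
- move=> j; transitivity (csym C (C ++ [::]) (j.+1)%N%:Z); last first.
    by rewrite cats0 csym_diag.
  rewrite (@csym_catr _ p) //; apply: eq_bigr => l _; congr (_ * _).
  by rewrite mxE /= ltn_ord csym_cancel.
- move=> i j i0 ji; rewrite mxE /=.
  have -> : (j < p)%N by have := ltn_ord i; lia.
  by rewrite csym_cancel csym_neg //; lia.
move=> i j ij; rewrite mxE /=.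
have jp : (j < p)%N by have := ltn_ord i; lia.
by rewrite jp csym_cancel (_ : _ - _ = 0) ?csym0 //; lia.
Qed.

End Determinants.

(** * Invariance of the determinants and polynomial forms *)

Section SchurTheory.
Variable K : comNzRingType.
Implicit Types C D : seq K.

Lemma schur_rect_perm p k C C' D :
  perm_eq C C' -> schur_rect p k C D = schur_rect p k C' D.
Proof.
move=> eqC; congr (\det _); apply/matrixP => i j.
by rewrite !mxE (csym_perm D eqC).
Qed.

Lemma schur_rect_cancel p k c C D :
  schur_rect p k (c :: C) (c :: D) = schur_rect p k C D.
Proof. by congr (\det _); apply/matrixP => i j; rewrite !mxE csym_cancel. Qed.

Lemma schur_col_perm n k C1 C1' C2 C2' D1 D2 :
  perm_eq C1 C1' -> perm_eq C2 C2' ->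
  schur_col n k C1 D1 C2 D2 = schur_col n k C1' D1 C2' D2.
Proof.
move=> eq1 eq2; congr (\det _); apply/matrixP => i j; rewrite !mxE.
by case: ifP => _; apply: csym_perm.
Qed.

Lemma schur_col_zeros n k C1 C2 D1 :
  schur_col n k C1 D1 C2 [::] = schur_col n k C1 D1 C2 (nseq k 0).
Proof.
congr (\det _); apply/matrixP => i j; rewrite !mxE; case: ifP => // _.
suff E m z : csym C2 (nseq m 0) z = csym C2 [::] z by [].
by elim: m z => //= m IH z; rewrite csym_consr mul0r subr0.
Qed.

(** This is x^(n-1) S_(1^(n-1); k)(C - x^-1; C - D), with the factor x put into
each of the first n - 1 columns through x S_i(C - x^-1) = x S_i(C) - S_(i-1)(C).
It involves no inverse of x, so it makes sense over F[x] as well as over F(x)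
and F. *)
Definition cleared_col n k C D (x : K) : K :=
  \det (\matrix_(l < n, j < n)
    if (j < n.-1)%N
    then x * csym C [::] ((1 + j)%N%:Z - (l : nat)%:Z)
         - csym C [::] ((1 + j)%N%:Z - (l : nat)%:Z - 1)
    else csym C D ((k + j)%N%:Z - (l : nat)%:Z)).

Lemma cleared_colE n k C D (x y : K) : x * y = 1 ->
  cleared_col n.+1 k C D x = x ^+ n * schur_col n.+1 k C [:: y] C D.
Proof.
move=> xy; pose s (j : 'I_n.+1) := if (j < n)%N then x else 1.
have -> : x ^+ n = \prod_j s j.
  rewrite big_ord_recr /= {2}/s ltnn mulr1 -[in LHS](card_ord n) -prodr_const.
  by apply: eq_bigr => j _; rewrite /s /= ltn_ord.
rewrite -det_scale_cols; congr (\det _); apply/matrixP => i j; rewrite !mxE /s.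
rewrite -!PoszD; case: ifP => _; last by rewrite mul1r.
by rewrite csym_consr mulrBr mulrA xy mul1r.
Qed.

End SchurTheory.

Section DegreeBounds.
Variable K : comNzRingType.
Implicit Types C D : seq K.

(** In each term of the Leibniz formula every column contributes one factor. *)
Lemma size_det_poly p (d : 'I_p -> nat) (M : 'M[{poly K}]_p) :
  (forall i j, (size (M i j) <= (d j).+1)%N) ->
  (size (\det M) <= (\sum_j d j).+1)%N.
Proof.
move=> sM; apply: (leq_trans (size_sum _ _ _)); apply/bigmax_leqP => s _.
rewrite -signr_odd mulr_sign.
rewrite [X in (_ <= X.+1)%N](reindex_inj (@perm_inj _ s)) /=.
have: (size (\prod_i M i (s i))%R <= (\sum_i d (s i)).+1)%N.
  apply: (big_ind2 (fun (q : {poly K}) m => (size q <= m.+1)%N)) => //.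
    by rewrite size_poly1.
  move=> q1 m1 q2 m2 h1 h2; apply: leq_trans (size_polyMleq _ _) _.
  by rewrite -subn1 leq_subLR; apply: leq_trans (leq_add h1 h2) _;
    rewrite addSn addnS add1n.
by case: ifP => _; rewrite ?size_polyN.
Qed.

Lemma csym_polyC C D j : csym (map polyC C) (map polyC D) j = (csym C D j)%:P.
Proof. exact: (@map_csym _ _ polyC). Qed.

Lemma size_schur_rect p k C :
  (size (schur_rect p k (map polyC C) [:: 'X]) <= p.+1)%N.
Proof.
apply: (leq_trans (@size_det_poly _ (fun=> 1%N) _ _)).
  move=> i j; rewrite mxE csym_consr (csym_polyC C [::]) (csym_polyC C [::]).
  apply: leq_trans (size_polyD _ _) _; rewrite size_polyN geq_max.
  rewrite (leq_trans (size_polyC_leq1 _)) //= mulrC mul_polyC.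
  by apply: leq_trans (size_scale_leq _ _) _; rewrite size_polyX.
by rewrite sum_nat_const card_ord muln1.
Qed.

Lemma size_cleared_col n k C D :
  (size (cleared_col n.+1 k (map polyC C) (map polyC D) 'X) <= n.+1)%N.
Proof.
apply: (leq_trans (@size_det_poly _ (fun j : 'I_n.+1 => (j < n)%N : nat) _ _)).
  move=> i j; rewrite mxE !(csym_polyC C [::]) csym_polyC /=; case: ifP => _.
    apply: leq_trans (size_polyD _ _) _; rewrite size_polyN geq_max.
    rewrite andbC (leq_trans (size_polyC_leq1 _)) //= mulrC mul_polyC.
    by apply: leq_trans (size_scale_leq _ _) _; rewrite size_polyX.
  exact: size_polyC_leq1.
rewrite ltnS big_ord_recr /= ltnn addn0.
apply: leq_trans (leq_sum _ (fun j _ => leq_b1 _)) _.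
by rewrite sum_nat_const card_ord muln1.
Qed.

End DegreeBounds.

Section Morphisms.
Variables (K L : comNzRingType) (f : {rmorphism K -> L}).

Lemma map_schur_rect p k C D :
  schur_rect p k (map f C) (map f D) = f (schur_rect p k C D).
Proof.
rewrite -det_map_mx; congr (\det _); apply/matrixP => i j.
by rewrite !mxE map_csym.
Qed.

Lemma map_cleared_col n k C D x :
  cleared_col n k (map f C) (map f D) (f x) = f (cleared_col n k C D x).
Proof.
rewrite -det_map_mx; congr (\det _); apply/matrixP => i j; rewrite !mxE.
by case: ifP => _; rewrite ?(map_csym f C [::]) ?map_csym // rmorphB rmorphM.
Qed.

End Morphisms.

(** * Remainders by interpolation *)

Section Remainders.
Variable F : fieldType.
Implicit Types (A B : seq F) (p q r : {poly F}).
Local Notation K := {fraction {poly F}}.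
Local Notation poly_inv := Defs.poly_inv.

(** The polynomial x^d q(x^-1), for q of degree at most d. *)
Definition revpoly (d : nat) q : {poly F} := \poly_(i < d.+1) q`_(d - i).

Lemma horner_revpoly d q a : (size q <= d.+1)%N -> a != 0 ->
  (revpoly d q).[a] = a ^+ d * q.[a^-1].
Proof.
move=> sq a0; rewrite horner_poly (horner_coef_wide _ sq) mulr_sumr.
rewrite (reindex_inj rev_ord_inj) /=; apply: eq_bigr => i _.
have le_id : (i <= d)%N by rewrite -ltnS.
rewrite subSS subKn // mulrCA; congr (_ * _).
by rewrite expfB_cond ?exprVn // (negPf a0).
Qed.

(** Multiplying the division identity of the true remainder r0 by a large power
of x gives an identity between polynomials, which shows that r0 and r agree at
the letters of A; both have degree less than the number of letters. *)
Lemma remainder_interpolation A q r : uniq A -> 0 \notin A ->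
  (size r <= size A)%N -> (forall a, a \in A -> r.[a] = q.[a^-1]) ->
  is_remainder A (poly_inv q) r.
Proof.
move=> uA A0 sr rA; have [r0 [rem0 _]] := remainder_exists_unique q A0.
have [s0 [q1 e]] := rem0; suff -> : r = r0 by [].
apply/eqP; rewrite -subr_eq0; apply/eqP.
apply: (@roots_geq_poly_eq0 _ _ A) => //; last first.
  by apply: leq_trans (size_polyD _ _) _; rewrite size_polyN geq_max sr.
apply/allP => a aA; have a0 : a != 0 by apply: contraNneq A0 => <-.
rewrite /root hornerD hornerN rA // subr_eq0; apply/eqP.
pose d := maxn (size q) (size q1).
have sq : (size q <= d.+1)%N := leqW (leq_maxl _ _).
have sq1 : (size q1 <= d.+1)%N := leqW (leq_maxr _ _).
have E : revpoly d q = revpoly d q1 * \prod_(b <- A) ('X - b%:P) + 'X^d * r0.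
  apply/eqP; rewrite -tofrac_eq rmorphD !rmorphM /= rmorphXn /=.
  have E0 : indet ^+ d * poly_inv q = (revpoly d q)%:F := Defs.poly_invE sq.
  have E1 : indet ^+ d * poly_inv q1 = (revpoly d q1)%:F := Defs.poly_invE sq1.
  by rewrite -E0 -E1 -RprodE -mulrA -mulrDr -e.
apply: (mulfI (expf_neq0 d a0)); rewrite -horner_revpoly // E hornerD !hornerM.
have /eqP -> : root (\prod_(b <- A) ('X - b%:P)) a by rewrite root_prod_XsubC.
by rewrite mulr0 add0r hornerXn.
Qed.

Definition cst_morph : {rmorphism F -> K} := (@FracField.tofrac {poly F}) \o polyC.

Lemma alph_tofrac A : alph A = map (@FracField.tofrac {poly F}) (map polyC A).
Proof. by rewrite -map_comp. Qed.

Lemma tofrac_schur_rect n k A :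
  (schur_rect n k (map polyC A) [:: 'X])%:F = schur_rect n k (alph A) [:: indet].
Proof. by rewrite -map_schur_rect alph_tofrac. Qed.

Lemma tofrac_cleared_col n k A B :
  (cleared_col n.+1 k (map polyC A) (map polyC B) 'X)%:F =
  indet ^+ n * schur_col n.+1 k (alph A) [:: indet^-1] (alph A) (alph B).
Proof.
have x0 : indet != 0 :> K by rewrite /indet tofrac_eq0 polyX_eq0.
by rewrite -map_cleared_col -!alph_tofrac (cleared_colE _ _ _ _ (mulfV x0)).
Qed.

Lemma Rprod_inv B :
  Rprod indet^-1 (alph B) = poly_inv (\prod_(b <- B) ('X - b%:P)).
Proof.
rewrite /Defs.poly_inv -[map_poly (@cst F) _]/(map_poly cst_morph _) rmorph_prod.
rewrite horner_prod /Rprod big_map; apply: eq_bigr => b _.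
by rewrite rmorphB /= map_polyX map_polyC hornerXsubC.
Qed.

Lemma indet_inv_exp k : (indet : K) ^- k = poly_inv 'X^k.
Proof.
rewrite /Defs.poly_inv -[map_poly (@cst F) _]/(map_poly cst_morph _).
by rewrite map_polyXn hornerXn exprVn.
Qed.

End Remainders.

Theorem theorem2p1 (F : fieldType) (n : nat) (n_gt0 : (0 < n)%N)
    (A : seq F) (sizeA : size A = n) (uniqA : uniq A) (A_neq0 : 0 \notin A) :
  let x : {fraction {poly F}} := indet in
  let u : F := \prod_(a <- A) a in
  let Av : seq F := [seq a^-1 | a <- A] in
  (forall k : nat,
     exists2 r : {poly F}, is_remainder A (x ^- k) r
       & r%:F = schur_rect n.-1 k (alph A) [:: x] * cst u ^- k
         /\
         r%:F = (-1) ^+ n.-1 * x ^+ n.-1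
                * schur_col n k (alph Av) [:: x^-1] (alph Av) [::])
  /\
  (forall (m : nat) (B : seq F) (sizeB : size B = m),
     exists2 r : {poly F}, is_remainder A (Rprod x^-1 (alph B)) r
       & r%:F = (-1) ^+ n.-1 * x ^+ n.-1
                * schur_col n m (alph Av) [:: x^-1] (alph Av) (alph B)).
Proof.
move=> x u Av.
case: n n_gt0 sizeA => // p _ sizeA; rewrite [p.+1.-1]/=.
have splitA a : a \in A -> [/\ a != 0, size (rem a A) = p,
    perm_eq A (a :: rem a A) & perm_eq Av (a^-1 :: [seq b^-1 | b <- rem a A])].
  move=> aA; split; last by rewrite (perm_map _ (perm_to_rem aA)).
  - by apply: contraNneq A_neq0 => <-.
  - by rewrite size_rem // sizeA.
  exact: perm_to_rem.
have evalX a : map (horner_eval a) [:: 'X] = [:: a].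
  by rewrite /= /horner_eval hornerX.
have evalC a (C : seq F) : map (horner_eval a) (map polyC C) = C.
  rewrite -map_comp -[RHS]map_id; apply: eq_map => c.
  by rewrite /= /horner_eval hornerC.
have rem_Rprod (B : seq F) :
    exists2 r : {poly F}, is_remainder A (Rprod x^-1 (alph B)) r
       & r%:F = (-1) ^+ p * x ^+ p
                * schur_col p.+1 (size B) (alph Av) [:: x^-1] (alph Av) (alph B).
  exists ((-1) ^+ p * cleared_col p.+1 (size B) (map polyC Av) (map polyC B) 'X).
    rewrite Rprod_inv; apply: remainder_interpolation => // [|a aA].
      rewrite -signr_odd mulr_sign sizeA.
      by case: ifP; rewrite ?size_polyN size_cleared_col.
    have [a0 sa _ pAv] := splitA a aA.
    (* At x = a the determinant is evaluated for the alphabet A^v = a^-1 :: C;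
       the signs and the powers of a cancel. *)
    rewrite hornerM horner_exp hornerN hornerC -/(horner_eval a _).
    rewrite -map_cleared_col !evalC.
    rewrite [X in cleared_col _ _ _ _ X](_ : _ = a); last exact: hornerX.
    rewrite (cleared_colE _ _ _ _ (mulfV a0)) (schur_col_perm _ _ _ _ pAv pAv).
    rewrite -[in p.+1]sa -(size_map (@GRing.inv F)) schur_col_letter size_map sa.
    rewrite !mulrA -!exprMn mulN1r mulrNN mulfV // expr1n mul1r horner_prod.
    by apply: eq_bigr => b _; rewrite hornerXsubC.
  by rewrite rmorphM rmorphXn rmorphN1 /= tofrac_cleared_col mulrA.
split=> [k|m B <-]; last exact: rem_Rprod.
pose r := (u ^- k)%:P * schur_rect p k (map polyC A) [:: 'X].
have rem : is_remainder A (x ^- k) r.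
  rewrite indet_inv_exp; apply: remainder_interpolation => // [|a aA].
    rewrite /r mul_polyC sizeA; apply: leq_trans (size_scale_leq _ _) _.
    exact: size_schur_rect.
  have [a0 sa pA _] := splitA a aA.
  rewrite /r hornerM hornerC hornerXn -/(horner_eval a _).
  rewrite -map_schur_rect evalC evalX.
  rewrite (schur_rect_perm _ _ _ pA) schur_rect_cancel -sa schur_rect_factor.
  rewrite /u (perm_big _ pA) big_cons exprMn invfM exprVn mulfVK //.
  apply: expf_neq0; rewrite prodf_seq_neq0; apply/allP => b /mem_rem bA.
  by have [] := splitA b bA.
exists r => //; split.
  rewrite /r rmorphM mulrC; congr (_ * _); first exact: tofrac_schur_rect.
  by rewrite -[LHS]/(cst_morph F (u ^- k)) fmorphV rmorphXn.
(* Both expressions must hold for the same polynomial, hence the appeal to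
   uniqueness of the remainder. *)
have [r' rem' Er'] := rem_Rprod (nseq k 0).
suff -> : r = r'.
  by rewrite Er' size_nseq schur_col_zeros /alph map_nseq /cst !rmorph0.
have [r0 [_ uniq_r]] := remainder_exists_unique 'X^k A_neq0.
rewrite -(uniq_r r); last by rewrite -indet_inv_exp.
apply: uniq_r; rewrite -indet_inv_exp.
suff <- : Rprod x^-1 (alph (nseq k 0)) = x ^- k by [].
by rewrite Rprod_inv indet_inv_exp big_nseq subr0 iter_mulr_1.
Qed.
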